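(* Let $X$ and $Y$ be completely regular topological spaces, let $f:X\times Y\to[-\infty,+\infty]$ be an extended real-valued function and let $K:X\rightrightarrows Y$ be a set-valued mapping with nonempty images. Suppose that: (i) the function $w(x):=\inf_{y\in Kx} f(x,y)$, $x\in X$, is bounded from above on $X$ and is proper as a function with values in $\mathbb{R}\cup\{-\infty\}$ (i.e. it has at least one finite value); (ii) $f$ is continuous on $X\times Y$ as a function into $[-\infty,+\infty]$; (iii) $K$ is both lower semicontinuous and upper semicontinuous in $X$ and has compact values. Let $\tilde S_f:C(X\times Y)\rightrightarrows X\times Y$ be the solution mapping that assigns to $u$ the (possibly empty) set of solutions of the supinf problem $\sup_{x\in X}\inf_{y\in Kx}\{f(x,y)+u(x,y)\}$. Then $\tilde S_f$ has dense domain $\mathrm{Dom}(\tilde S_f)$ in $C(X\times Y)$, has closed graph $\mathrm{Gr}(\tilde S_f)$, is quasi-continuous, and is open as a mapping from $C(X\times Y)$ into $\mathrm{Gr}(K)$.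
   Context: Completely regular spaces are understood to be Hausdorff. $X\times Y$ carries the product topology, and $[-\infty,+\infty]$ its usual extended (order) topology. $C(X\times Y)$ is the Banach space of all bounded continuous real-valued functions on $X\times Y$ with the sup norm $\|u\|_{X\times Y,\infty}=\sup|u(x,y)|$. For a function $F:X\times Y\to[-\infty,+\infty]$, a solution of the supinf problem $\sup_{x\in X}\inf_{y\in Kx}F(x,y)$ is a pair $(x_0,y_0)\in X\times Y$ with $y_0\in Kx_0$ and $F(x_0,y_0)=\inf_{y\in Kx_0}F(x_0,y)=\sup_{x\in X}\inf_{y\in Kx}F(x,y)$. For a set-valued mapping $\Phi:Z\rightrightarrows T$ between topological spaces (values may be empty): $\mathrm{Dom}(\Phi)=\{z\in Z:\Phi(z)\neq\emptyset\}$; $\mathrm{Gr}(\Phi)=\{(z,t):t\in\Phi(z)\}$, and closedness of the graph is in the product topology of $Z\times T$; $\Phi(U)=\bigcup_{z\in U}\Phi(z)$. $\Phi$ is upper semicontinuous (usc) at $z_0$ if for every open $V\supset\Phi(z_0)$ there is an open $U\ni z_0$ with $\Phi(z)\subset V$ for all $z\in U$. A $\Phi$ with nonempty images is lower semicontinuous (lsc) at $z_0$ if for every open $V$ with $V\cap\Phi(z_0)\neq\emptyset$ there is an open $U\ni z_0$ with $\Phi(z)\cap V\ne\emptyset$ for all $z\in U$. $\Phi$ is usc (lsc) in $Z$ if it is so at every point. $\Phi$ is quasi-continuous if for all open $U\subset Z$ and $V\subset T$ with $\Phi(U)\cap V\neq\emptyset$ there is a nonempty open $U'\subset U$ with $\Phi(U')\subset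 V$. $\tilde S_f$ is open into $\mathrm{Gr}(K)$ if for every open $O\subset C(X\times Y)$ the set $\tilde S_f(O)$ is an open subset of $\mathrm{Gr}(K)$, where $\mathrm{Gr}(K)\subset X\times Y$ has the subspace topology. *)

(* Defs.v *)
From HB Require Import structures.
From mathcomp Require Import all_boot all_order all_algebra.
From mathcomp Require Import all_classical all_reals all_analysis.

Set Implicit Arguments.
Unset Strict Implicit.
Unset Printing Implicit Defensive.

Import Order.TTheory GRing.Theory Num.Theory.
Import numFieldNormedType.Exports.

Local Open Scope classical_set_scope.
Local Open Scope ring_scope.

Section BoundedContinuousFunctions.
Context {R : realType} {T : topologicalType}.

Definition bounded_continuous : {pred T -> R} :=
  [pred u : T -> R | `[< continuous u /\ bounded_fun u >]].

Lemma bounded_continuousP (u : T -> R) :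
  reflect (continuous u /\ bounded_fun u) (u \in bounded_continuous).
Proof. exact: asboolP. Qed.

Lemma bounded_funE (u : T -> R) :
  bounded_fun u <-> exists M, forall t, `|u t| <= M.
Proof.
split=> [[M [_ uM]]|[M uM]].
  by exists (M + 1) => t; apply: (uM (M + 1)); rewrite ?ltrDl.
exists M; split; first exact: num_real.
by move=> N /ltW MN t _ /=; exact: le_trans (uM t) MN.
Qed.

Lemma bounded_continuous_submod : submod_closed bounded_continuous.
Proof.
split.
  apply/bounded_continuousP; split; first by move=> x; exact: cvg_cst.
  by apply/bounded_funE; exists 0 => t; rewrite normr0.
move=> a u v /bounded_continuousP[cu bu] /bounded_continuousP[cv bv].
apply/bounded_continuousP; split.
  by move=> x; apply: cvgD; [apply: cvgMr; exact: cu | exact: cv].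
move/bounded_funE: bu => [M uM]; move/bounded_funE: bv => [N vN].
apply/bounded_funE; exists (`|a| * M + N) => t.
rewrite (le_trans (ler_normD _ _))// lerD ?vN//.
by rewrite normrM ler_wpM2l// uM.
Qed.

HB.instance Definition _ :=
  GRing.isSubmodClosed.Build R (T -> R) bounded_continuous
    bounded_continuous_submod.

End BoundedContinuousFunctions.

(* [bcfun R T] is the space C(T) of bounded continuous functions T -> R. *)
Record bcfun (R : realType) (T : topologicalType) := BCFun {
  bcfun_val :> T -> R;
  _ : bcfun_val \in @bounded_continuous R T
}.

Section SupNorm.
Context {R : realType} {T : topologicalType}.

HB.instance Definition _ := [isSub for @bcfun_val R T].
HB.instance Definition _ := [Choice of bcfun R T by <:].
HB.instance Definition _ := [SubChoice_isSubLmodule of bcfun R T by <:].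

Definition sup_norm (u : bcfun R T) : R := sup (range (fun t => `|u t|)).

Lemma bcfun_has_ubound (u : bcfun R T) : has_ubound (range (fun t => `|u t|)).
Proof.
case: u => u /= /bounded_continuousP[_ /bounded_funE[M uM]].
by exists M => _ [t _ <-]; exact: uM.
Qed.

Lemma le_sup_norm (u : bcfun R T) t : `|u t| <= sup_norm u.
Proof. by apply: ub_le_sup; [exact: bcfun_has_ubound | exists t]. Qed.

Lemma sup_norm_ge0 (u : bcfun R T) : 0 <= sup_norm u.
Proof.
have [[t _]|ne] := pselect (exists t : T, True).
  exact: le_trans (normr_ge0 _) (le_sup_norm u t).
rewrite /sup_norm (_ : [set _ | _ in _] = set0) ?sup0//.
by rewrite -subset0 => r [t _ _]; apply: ne; exists t.
Qed.

Lemma sup_norm_le (u : bcfun R T) M :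
  0 <= M -> (forall t, `|u t| <= M) -> sup_norm u <= M.
Proof.
move=> M0 uM; have [u0|ne] := eqVneq (range (fun t => `|u t|)) set0.
  by rewrite /sup_norm u0 sup0.
apply: ge_sup; first exact/set0P.
by move=> _ [t _ <-].
Qed.

Lemma ler_sup_normD (u v : bcfun R T) :
  sup_norm (u + v) <= sup_norm u + sup_norm v.
Proof.
apply: sup_norm_le; first by rewrite addr_ge0 ?sup_norm_ge0.
by move=> t; rewrite (le_trans (ler_normD _ _))// lerD ?le_sup_norm.
Qed.

Lemma sup_normZ (a : R) (u : bcfun R T) :
  sup_norm (a *: u) = `|a| * sup_norm u.
Proof.
have le b (v : bcfun R T) : sup_norm (b *: v) <= `|b| * sup_norm v.
  apply: sup_norm_le; first by rewrite mulr_ge0 ?sup_norm_ge0.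
  by move=> t; rewrite normrM ler_wpM2l// le_sup_norm.
apply/eqP; rewrite eq_le le/=; have [->|a0] := eqVneq a 0.
  by rewrite normr0 mul0r sup_norm_ge0.
rewrite -ler_pdivlMl ?normr_gt0// -normfV.
by rewrite -[in leLHS](scalerK a0 u) le.
Qed.

Lemma sup_norm0_eq0 (u : bcfun R T) : sup_norm u = 0 -> u = 0.
Proof.
move=> u0; apply: val_inj; apply/funext => t.
by apply/eqP; rewrite -normr_le0 -u0 le_sup_norm.
Qed.

HB.instance Definition _ :=
  Lmodule_isNormed.Build R (bcfun R T) ler_sup_normD sup_normZ sup_norm0_eq0.

End SupNorm.

(* A set-valued mapping from Z to T is a function Z -> set T. *)
Section SetValuedMappings.
Context {Z T : topologicalType}.
Implicit Types Phi : Z -> set T.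

Definition svdom Phi : set Z := [set z | Phi z !=set0].

Definition svgraph Phi : set (Z * T) := [set p | Phi p.1 p.2].

Definition svimage Phi (U : set Z) : set T := \bigcup_(z in U) Phi z.

Definition usc Phi := forall (z0 : Z) (V : set T), open V -> Phi z0 `<=` V ->
  exists U : set Z, [/\ open U, U z0 & forall z, U z -> Phi z `<=` V].

Definition lsc Phi := forall (z0 : Z) (V : set T), open V ->
  V `&` Phi z0 !=set0 ->
  exists U : set Z, [/\ open U, U z0 & forall z, U z -> Phi z `&` V !=set0].

Definition quasi_continuous Phi := forall (U : set Z) (V : set T),
  open U -> open V -> svimage Phi U `&` V !=set0 ->
  exists U' : set Z, [/\ open U', U' !=set0, U' `<=` U & svimage Phi U' `<=` V].

(* Relatively open subset of A; in particular B `<=` A. *)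
Definition open_in (A B : set T) := exists2 W : set T, open W & B = A `&` W.

Definition open_into Phi (A : set T) :=
  forall O : set Z, open O -> open_in A (svimage Phi O).

End SetValuedMappings.

Section SupInf.
Context {R : realType} {X Y : topologicalType}.
Implicit Types (K : X -> set Y) (F f : X * Y -> \bar R).

Definition inf_value K F (x : X) : \bar R := ereal_inf [set F (x, y) | y in K x].

Definition supinf_value K F : \bar R := ereal_sup (range (inf_value K F)).

Definition supinf_solution K F (p : X * Y) :=
  [/\ K p.1 p.2, F p = inf_value K F p.1 & inf_value K F p.1 = supinf_value K F].

Definition solution_map f K (u : bcfun R (X * Y)%type) : set (X * Y) :=
  [set p | supinf_solution K (fun q => f q + (u q)%:E)%E p].

End SupInf.

(* Main.v *)
Require Import Defs.
From mathcomp Require Import all_boot all_order all_algebra.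
From mathcomp Require Import all_classical all_reals all_analysis.
From mathcomp Require Import lra.

Import Order.TTheory GRing.Theory Num.Theory.
Import numFieldNormedType.Exports.

Local Open Scope classical_set_scope.
Local Open Scope ring_scope.

(** Adding a function of [x] alone to [f] shifts the inner infimum
    [w u x = inf_(y in K x) (f + u)(x, y)] by that function.  This makes the
    supinf problem easy to steer: when [w u x0 = t] is attained at [(x0, y0)] and
    is within [d] of the optimal value, subtracting the excess of [w u] over [t]
    yields [v] with [w v = min (w u) t], so [(x0, y0)] solves the problem for [v]
    and [v] is at distance at most [d] from [u] ([cap_perturbation]).  The
    subtracted function has to be continuous, which holds because [w u] is
    continuous as a map into the extended reals ([continuous_inf_value]): lower
    semicontinuity of [K] makes [w u] upper semicontinuous, and upper
    semicontinuity together with compact values makes it lower semicontinuous, by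
    the tube lemma.

    Density of the domain is the capping applied at a near-maximizer of [w u].

    The graph is closed because being a solution amounts to [y \in K x],
    [(f + u)(x, y) <= s u] and [s u <= w u x], where the optimal value [s u] is
    finite and 1-Lipschitz in [u], and the graph of [K] is itself closed.

    For openness, start from a solution [(x0, y0)] for [u0].  At a nearby point
    [(x, y)] of the graph of [K] the value [t = (f + u0)(x, y)] is close to the
    optimal one, but [y] need not be a minimizer over [K x].  Raising [f + u0] by at
    most [2 d] so as to lift to [t] the values lying between [t - 2 d] and [t]
    makes [y] a minimizer, and capping at level [t] then makes [(x, y)] a solution.

    For quasi-continuity, start from a solution [(x0, y0)] for [u0] inside an open
    set [V].  Add a multiple of a bump that penalizes [y] far from [y0] in the
    infimum, subtract a larger multiple of a bump that penalizes [x] far from [x0]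
    in the supremum, and cap at the old optimal value: [(x0, y0)] remains a
    solution, and all solutions for the functions in a small ball around the
    result lie in [V]. *)

(** * Topological preliminaries *)

Lemma continuous_ray {d} {S : topologicalType} {T : orderTopologicalType d}
    (g : S -> T) :
  (forall x c, (c < g x)%O -> \forall z \near x, (c < g z)%O) ->
  (forall x c, (g x < c)%O -> \forall z \near x, (g z < c)%O) ->
  continuous g.
Proof.
move=> gl gu x B; rewrite itv_nbhsE => -[i [oi xi] iB].
suff : \forall z \near x, g z \in i by apply: filterS => z; exact: iB.
case: i oi xi {iB} => [[[] a|[]] [[] b|[]]] // _; rewrite in_itv/= ?andbT.
- move=> /andP[/gl ax /gu xb]; apply: filterS2 ax xb => z az zb.
  by rewrite in_itv/= az.
- by move=> /gl; apply: filterS => z az; rewrite in_itv/= az.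
- by move=> /gu.
- by move=> _; apply: filterE.
Qed.

Lemma near_gt_continuous {S : topologicalType} {R : realType}
    {g : S -> \bar R} : continuous g ->
  forall x c, (c < g x)%E -> \forall z \near x, (c < g z)%E.
Proof. by move=> cg x c cx; exact: (cg x _ (open_ereal_gt' cx)). Qed.

Lemma near_lt_continuous {S : topologicalType} {R : realType}
    {g : S -> \bar R} : continuous g ->
  forall x c, (g x < c)%E -> \forall z \near x, (g z < c)%E.
Proof. by move=> cg x c xc; exact: (cg x _ (open_ereal_lt' xc)). Qed.

Lemma tube {S T : topologicalType} (A : set T) (x : S) (W : set (S * T)) :
  compact A -> (forall y, A y -> nbhs (x, y) W) ->
  exists2 V : set T, open V /\ A `<=` V &
    \forall x' \near x, forall y, V y -> W (x', y).
Proof.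
move=> /compact_near_coveringP Ac AW.
(* The covering is indexed by the small neighbourhoods U of x, so that a single
   U serves all points of A; taking y' near y, rather than y alone, is what
   yields an open V instead of A itself. *)
have := Ac _ (powerset_filter_from (nbhs x))
  (fun U y => \forall y' \near y, forall x', U x' -> W (x', y')) _.
case.
  move=> y /AW [[P Q] /= [xP yQ] PQW].
  exists (interior Q, [set U | U `<=` P]) => /=.
    split; first exact: nbhs_interior.
    by near=> U; near: U; exact: small_set_sub.
  move=> [y' U] /= [Qy' UP]; apply: filterS Qy' => z Qz x' /UP Px'.
  exact: PQW.
move=> D [Dsub _ [U DU]] /(_ U DU) AU.
have xU : nbhs x U by exact: Dsub.
exists (interior [set y | forall x', U x' -> W (x', y)]).
  by split; [exact: open_interior|].
by apply: filterS xU => x' Ux' y /interior_subset; exact.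
Unshelve. all: by end_near.
Qed.

(** The real extreme value theorem applies after composing with the increasing
    map [contract], whose distance defines the topology of the extended reals. *)
Lemma compact_emin {R : realType} {T : topologicalType} {g : T -> \bar R}
    {A : set T} : continuous g -> A !=set0 -> compact A ->
  exists2 y, A y & g y = ereal_inf (g @` A).
Proof.
move=> cg A0 cA.
have [] := @compact_EVT_min _ _ (fun y => contract (g y)) A A0 cA.
  apply: continuous_subspaceT => y; apply/cvgrPdist_lt => e e0.
  have : \forall z \near y, ball (g y) e (g z).
    by apply: cg; exact: nbhsx_ballx.
  by apply: filterS => z.
move=> y; rewrite inE => Ay ymin; exists y => //; apply/eqP; rewrite eq_le.
rewrite ereal_inf_lbound ?andbT; last by exists y.
apply: le_ereal_inf_tmp => _ [z Az <-].
by rewrite -le_contract; apply: ymin; rewrite inE.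
Qed.

Lemma completely_regular_bump {R : realType} {T : topologicalType} {x : T}
    {A : set T} : completely_regular_space T -> nbhs x A ->
  exists g : T -> R, [/\ continuous g, forall z, 0 <= g z <= 1, g x = 0 &
    forall z, g z < 1 -> A z].
Proof.
move=> crT xA.
have cA : closed (~` interior A) by exact/open_closedC/open_interior.
have /(uniform_separatorP (R := R))[g [cg g01 gx gA]] :
    uniform_separator [set x] (~` interior A).
  by apply: crT => //; apply; exact: nbhs_interior.
exists g; split => // [z||z gz].
- by have /g01 : range g (g z) by exists z.
- by apply: gx; exists x.
apply: interior_subset; apply: contrapT => nAz.
by move: gz; rewrite (gA (g z)) ?ltxx//; exists z.
Qed.

(** * Clamping extended reals to a real interval *)

(** Truncation turns the extended-valued functions of the problem into bounded
    real ones, which can be added to a perturbation. *)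
Definition clamp {R : realType} (a b : R) (x : \bar R) : R :=
  match x with
  | r%:E => Num.min (Num.max r a) b
  | +oo%E => b
  | -oo%E => a
  end.

Lemma clamp_ge {R : realType} {a b : R} x : a <= b -> a <= clamp a b x.
Proof. by case: x => [r| |] ab //=; rewrite le_min le_max lexx orbT. Qed.

Lemma clamp_le {R : realType} {a b : R} x : a <= b -> clamp a b x <= b.
Proof. by case: x => [r| |] ab //=; rewrite ge_min lexx orbT. Qed.

Lemma lt_clamp {R : realType} {a b : R} (c : R) x : a <= b ->
  (c < clamp a b x) = (c < a) || (c < b) && (c%:E < x)%E.
Proof.
move=> ab; have [ca|ac] := ltP c a.
  by rewrite (lt_le_trans ca (clamp_ge _ ab)).
case: x => [r| |] /=.
- by rewrite lte_fin lt_min lt_max (ltNge c a) ac orbF andbC.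
- by rewrite ltry andbT.
- by rewrite ltNge ac [(_ < -oo)%E]ltNge leNye andbF.
Qed.

Lemma clamp_lt {R : realType} {a b : R} (c : R) x : a <= b ->
  (clamp a b x < c) = (b < c) || (a < c) && (x < c%:E)%E.
Proof.
move=> ab; have [bc|cb] := ltP b c.
  by rewrite (le_lt_trans (clamp_le _ ab) bc).
case: x => [r| |] /=.
- by rewrite lte_fin gt_min gt_max (ltNge b c) cb orbF andbC.
- by rewrite ltNge cb [(+oo < _)%E]ltNge leey andbF.
- by rewrite ltNyr andbT.
Qed.

Lemma continuous_clamp {R : realType} {a b : R} :
  a <= b -> continuous (clamp a b).
Proof.
move=> ab; apply: continuous_ray => x c.
- rewrite lt_clamp// => /orP[ca|/andP[cb cx]].
    by apply: nearW => z; rewrite lt_clamp// ca.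
  apply: filterS (open_ereal_gt' cx) => z cz.
  by rewrite lt_clamp// cb cz orbT.
- rewrite clamp_lt// => /orP[bc|/andP[ac xc]].
    by apply: nearW => z; rewrite clamp_lt// bc.
  apply: filterS (open_ereal_lt' xc) => z zc.
  by rewrite clamp_lt// ac zc orbT.
Qed.

Lemma le_EFin_clamp {R : realType} {a b : R} {x : \bar R} :
  (x <= b%:E)%E -> (x <= (clamp a b x)%:E)%E.
Proof.
case: x => [r| |] /=; last by rewrite !leNye.
  by rewrite !lee_fin le_min le_max lexx => ->.
by rewrite leye_eq.
Qed.

Lemma clamp_le_max {R : realType} {a b c : R} {x : \bar R} :
  a <= b -> a <= c -> (x <= c%:E)%E -> clamp a b x <= c.
Proof.
case: x => [r| |] //= ab ac.
by rewrite lee_fin => rc; rewrite ge_min ge_max rc ac.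
Qed.

Lemma EFin_lt_gap {R : realType} {s : R} {x : \bar R} : (s%:E < x)%E ->
  exists2 e : R, 0 < e & ((s + e)%:E < x)%E.
Proof.
case: x => [r| |]//.
  by rewrite lte_fin => sr; exists ((r - s) / 2); rewrite ?lte_fin; lra.
by move=> _; exists 1; rewrite ?ltr01 ?ltry.
Qed.

Lemma lt_EFin_gap {R : realType} {s : R} {x : \bar R} : (x < s%:E)%E ->
  exists2 e : R, 0 < e & (x < (s - e)%:E)%E.
Proof.
case: x => [r| |]//.
  by rewrite lte_fin => sr; exists ((s - r) / 2); rewrite ?lte_fin; lra.
by move=> _; exists 1; rewrite ?ltr01 ?ltNyr.
Qed.

(** * Distances between bounded continuous functions *)

Lemma exists_bcfun {R : realType} {T : topologicalType} {g : T -> R} {M : R} :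
  continuous g -> (forall t, `|g t| <= M) -> exists u : bcfun R T, u =1 g.
Proof.
move=> cg gM.
have gP : g \in @bounded_continuous R T.
  by apply/bounded_continuousP; split=> //; apply/bounded_funE; exists M.
by exists (BCFun gP).
Qed.

Lemma bcfun_continuous {R : realType} {T : topologicalType} (u : bcfun R T) :
  continuous u.
Proof. by case: u => u /= /bounded_continuousP[]. Qed.

Lemma bcfun_dist {R : realType} {T : topologicalType} (u v : bcfun R T) t :
  `|u t - v t| <= `|u - v|.
Proof. exact: (le_sup_norm (u - v) t). Qed.

Lemma bcfun_dist_le {R : realType} {T : topologicalType} (u v : bcfun R T) d :
  0 <= d -> (forall t, `|u t - v t| <= d) -> `|u - v| <= d.
Proof. exact: (@sup_norm_le R T (u - v)). Qed.

Lemma bcfun_le_dist {R : realType} {T : topologicalType} (u v : bcfun R T) t :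
  u t <= v t + `|u - v|.
Proof. by have := bcfun_dist u v t; rewrite ler_norml; lra. Qed.

Lemma open_bcfun_dist {R : realType} {T : topologicalType}
    {O : set (bcfun R T)} {u} : open O -> O u ->
  exists2 e : R, 0 < e & forall v, `|u - v| < e -> O v.
Proof.
move=> oO Ou; have /nbhs_ballP[e /= e0 eO] := open_nbhs_nbhs (conj oO Ou).
by exists e => // v uv; apply: eO; rewrite -ball_normE.
Qed.

Lemma nbhs_bcfun_dist {R : realType} {T : topologicalType} (u : bcfun R T)
    (e : R) : 0 < e -> \forall v \near u, `|u - v| < e.
Proof. by move=> e0; have := nbhsx_ballx u e e0; rewrite -ball_normE. Qed.

(** * The inner infimum *)

Section InfValue.
Context {R : realType} {X Y : topologicalType} {K : X -> set Y}.
Context (K_nonempty : forall x, K x !=set0).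
Context (K_lsc : lsc K) (K_usc : usc K) (K_compact : forall x, compact (K x)).
Implicit Types (F G : X * Y -> \bar R).

Lemma inf_value_le {F x y} : K x y -> (inf_value K F x <= F (x, y))%E.
Proof. by move=> Kxy; apply: ereal_inf_lbound; exists y. Qed.

Lemma inf_value_leD {F G x} {d : R} :
  (forall y, K x y -> (F (x, y) <= G (x, y) + d%:E)%E) ->
  (inf_value K F x <= inf_value K G x + d%:E)%E.
Proof.
move=> FG; rewrite -leeBlDr//; apply: le_ereal_inf_tmp => _ [y Kxy <-].
by rewrite leeBlDr//; apply: le_trans (FG y Kxy); exact: inf_value_le.
Qed.

Lemma continuous_pair {F} : continuous F ->
  forall x, continuous (fun y => F (x, y)).
Proof.
move=> cF x y.
apply: (@continuous_comp _ _ _ (fun y => (x, y)) F); last exact: cF.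
by apply: cvg_pair => //=; exact: cvg_cst.
Qed.

Lemma inf_value_attained {F} : continuous F ->
  forall x, exists2 y, K x y & F (x, y) = inf_value K F x.
Proof.
by move=> cF x; apply: compact_emin => //; exact: continuous_pair.
Qed.

(** The two halves of the continuity of [K] play separate roles: a nearly optimal
    [y] for [x] has near counterparts in [K x'] by lower semicontinuity, while a
    strict lower bound over the compact set [K x] extends to a tube around it, which
    contains [K x'] by upper semicontinuity. *)
Lemma continuous_inf_value {F} : continuous F -> continuous (inf_value K F).
Proof.
move=> cF; apply: continuous_ray => x c.
- move=> cx; have [y Ky|V [oV KV] xV] := @tube _ _ (K x) x [set p | c < F p]%E
      (K_compact x).
    apply: (cF (x, y) _ (open_ereal_gt' _)).
    by apply: lt_le_trans cx _; exact: inf_value_le.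
  have [U [oU Ux UV]] := K_usc x V oV KV.
  apply: filterS2 xV (open_nbhs_nbhs (conj oU Ux)) => x' WV Ux'.
  have [y Ky <-] := inf_value_attained cF x'.
  by apply: WV; exact: UV Ky.
- move=> /ereal_inf_lt[_ [y Ky <-] Fc].
  have [[A B] /= [xA yB] AB] := cF (x, y) _ (open_ereal_lt' Fc).
  have BK : interior B `&` K x !=set0 by exists y.
  have [U [oU Ux UB]] := K_lsc x _ (open_interior B) BK.
  apply: filterS2 xA (open_nbhs_nbhs (conj oU Ux)) => x' Ax' /UB[y' [Ky' By']].
  apply: le_lt_trans (inf_value_le Ky') _.
  by apply: (AB (x', y')); split => //; exact: interior_subset.
Qed.

(** Hausdorff separation of a point from each point of the compact set [K x]
    becomes, by the tube lemma, a separation from [K x] as a whole. *)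
Lemma closed_svgraph : hausdorff_space Y -> closed (svgraph K).
Proof.
rewrite open_hausdorff => hY; rewrite -openC openE => -[x y] /= nKxy.
have [y' Ky'|V [oV KV] yV] := @tube _ _ (K x) y [set p | p.1 != p.2]
    (K_compact x).
  have yy' : y != y' by apply: contra_notN nKxy => /eqP ->.
  have [[A B] [/= /set_mem Ay /set_mem By' [oA oB /eqP AB0]]] := hY _ _ yy'.
  exists (A, B) => /=; first by split; apply: open_nbhs_nbhs.
  move=> [a b] /= [Aa Bb]; apply/eqP => ab.
  suff : (A `&` B) a by rewrite AB0.
  by split => //; rewrite ab.
have [U [oU Ux UV]] := K_usc x V oV KV.
exists (U, [set y | V `<=` [set~ y]]) => /=.
  split; first by apply: open_nbhs_nbhs.
  by apply: filterS yV => z zV v /zV /eqP zv vz; apply: zv.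
move=> [x' y'] /= [Ux' Vy'] Kxy'.
by have := Vy' _ (UV _ Ux' _ Kxy'); apply.
Qed.

End InfValue.

(** * Perturbed problems *)

Section Perturbation.
Context {R : realType} {X Y : topologicalType}.
Context {f : X * Y -> \bar R} {K : X -> set Y}.
Context (K_nonempty : forall x, K x !=set0).
Context (w_bounded_above : exists M : R, forall x, (inf_value K f x <= M%:E)%E).
Context (w_proper : exists x, inf_value K f x \is a fin_num).
Context (f_cont : continuous f).
Context (K_lsc : lsc K) (K_usc : usc K) (K_compact : forall x, compact (K x)).

Definition perturbed (u : bcfun R (X * Y)%type) (q : X * Y) : \bar R :=
  (f q + (u q)%:E)%E.

(** Taking [fine] loses nothing: the optimal value is finite by
    [supinf_perturbed]. *)
Definition opt (u : bcfun R (X * Y)%type) : R :=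
  fine (supinf_value K (perturbed u)).

Implicit Types (u v : bcfun R (X * Y)%type) (q : X * Y).

Local Notation w u := (inf_value K (perturbed u)).

Lemma continuous_perturbed u : continuous (perturbed u).
Proof.
move=> q; apply: cvgeD; first by rewrite fin_num_adde_defl.
- exact: f_cont.
- by apply: cvg_EFin; [exact: nearW | exact: bcfun_continuous].
Qed.

Lemma continuous_inf_perturbed u : continuous (w u).
Proof. exact: continuous_inf_value (continuous_perturbed u). Qed.

Lemma perturbed_leD {u v q} {d : R} :
  u q <= v q + d -> (perturbed u q <= perturbed v q + d%:E)%E.
Proof. by move=> uv; rewrite -addeA leeD2l// lee_fin. Qed.

Lemma inf_perturbed_leD {u v x} {d : R} :
  (forall y, u (x, y) <= v (x, y) + d) -> (w u x <= w v x + d%:E)%E.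
Proof. by move=> uv; apply: inf_value_leD => y _; exact: perturbed_leD. Qed.

Lemma inf_perturbed_dist u v x : (w u x <= w v x + `|u - v|%:E)%E.
Proof. by apply: inf_perturbed_leD => y; exact: bcfun_le_dist. Qed.

(** Finiteness transfers from [f] to every perturbation because the inner infima
    differ by at most the norm of the perturbation: the upper bound on [w] keeps the
    supremum below [+oo], and a finite value of [w] keeps it above [-oo]. *)
Lemma supinf_perturbed u : supinf_value K (perturbed u) = (opt u)%:E.
Proof.
rewrite fineK// fin_real//.
have f0 : perturbed 0 = f by apply/funext => q; rewrite /perturbed /= adde0.
apply/andP; split.
  have [x fx] := w_proper.
  apply: lt_le_trans (ereal_sup_ubound _); last by exists x.
  have := inf_perturbed_dist 0 u x; rewrite f0.
  case: (w u x) => [r| |]; rewrite ?ltNyr ?ltry//.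
  by rewrite leNgt /= ltNye; case/fin_numP: fx => ->.
have [M wM] := w_bounded_above.
apply: (@le_lt_trans _ _ (M + `|u - 0|)%:E); last by rewrite ltry.
apply: ge_ereal_sup => _ [x _ <-].
by apply: le_trans (inf_perturbed_dist u 0 x) _; rewrite f0 EFinD leeD2r.
Qed.

Lemma inf_perturbed_le u x : (w u x <= (opt u)%:E)%E.
Proof. by rewrite -supinf_perturbed; apply: ereal_sup_ubound; exists x. Qed.

Lemma opt_le u (t : R) : (forall x, (w u x <= t%:E)%E) -> opt u <= t.
Proof.
move=> ut; rewrite -lee_fin -supinf_perturbed.
by apply: ge_ereal_sup => _ [x _ <-].
Qed.

Lemma opt_leD u v (d : R) : (forall q, u q <= v q + d) -> opt u <= opt v + d.
Proof.
move=> uv; apply: opt_le => x.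
apply: le_trans (inf_perturbed_leD (fun y => uv (x, y))) _.
by rewrite EFinD leeD2r// inf_perturbed_le.
Qed.

Lemma opt_dist u v : opt u <= opt v + `|u - v|.
Proof. by apply: opt_leD => q; exact: bcfun_le_dist. Qed.

Lemma opt_gt u (t : R) : t < opt u -> exists x, (t%:E < w u x)%E.
Proof.
rewrite -lte_fin -supinf_perturbed => /ereal_sup_gt[_ [x _ <-] tx].
by exists x.
Qed.

Lemma solution_mapP u q :
  solution_map f K u q <-> [/\ K q.1 q.2, perturbed u q = (opt u)%:E &
                               w u q.1 = (opt u)%:E].
Proof.
rewrite -supinf_perturbed; split => -[Kq uq wq]; split => //.
  exact: etrans uq wq.
exact: etrans uq (esym wq).
Qed.

(** The two values are squeezed between these bounds, because [w u x] is at most both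
    [(f + u)(x, y)] and [opt u].  Unlike the equalities in the definition of a
    solution, each bound is preserved on its own in the limit along which the graph
    is closed. *)
Lemma solution_map_suff u q : K q.1 q.2 -> (perturbed u q <= (opt u)%:E)%E ->
  ((opt u)%:E <= w u q.1)%E -> solution_map f K u q.
Proof.
case: q => x y /= Kxy uq wq; apply/solution_mapP => /=.
have wu : (w u x <= perturbed u (x, y))%E by exact: inf_value_le.
split => //; apply/eqP; rewrite eq_le ?uq ?wq ?inf_perturbed_le//.
by rewrite (le_trans wq).
Qed.

(** The witness is [u q + (t - clamp t (t + d) (w u q.1))]; as [w u <= t + d], the
    clamped value is the maximum of [w u] and [t].  The last two conclusions say
    that the correction is downwards, and small wherever [w u] is not much larger
    than [t]; they serve to localize the solutions for functions near [v]. *)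
Lemma cap_perturbation {u x y} {t d : R} : 0 <= d -> K x y ->
    perturbed u (x, y) = t%:E -> w u x = t%:E -> opt u <= t + d ->
  exists v, [/\ `|u - v| <= d, solution_map f K v (x, y), opt v = t,
    forall q, v q <= u q &
    forall q (e : R), 0 <= e -> (w u q.1 <= (t + e)%:E)%E -> u q <= v q + e].
Proof.
move=> d0 Kxy uxy wx ut.
have tt : t <= t + d by rewrite lerDl.
pose c z := clamp t (t + d) (w u z).
have cg : continuous (fun q => u q + (t - c q.1)).
  move=> q; apply: cvgD; first exact: bcfun_continuous.
  apply: cvgB; first exact: cvg_cst.
  apply: (@continuous_comp _ _ _ fst c); first exact: cvg_fst.
  apply: continuous_comp; first exact: continuous_inf_perturbed.
  exact: continuous_clamp.
have cP z : t <= c z <= t + d by rewrite clamp_ge// clamp_le.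
have [|v vE] := @exists_bcfun _ _ _ (`|u| + d) cg.
  move=> q; apply: le_trans (ler_normD _ _) _; apply: lerD.
    exact: (le_sup_norm u).
  by have := cP q.1; rewrite ler_norml; lra.
have wv z : (w v z <= t%:E)%E.
  have : (w v z <= w u z + (t - c z)%:E)%E.
    by apply: inf_perturbed_leD => y'; rewrite vE.
  have : (w u z <= (c z)%:E)%E.
    by apply: le_EFin_clamp; apply: le_trans (inf_perturbed_le u z) _.
  case: (w u z) => [r| |]; rewrite ?leye_eq// ?addNye; last first.
    by move=> _ /le_trans; apply; exact: leNye.
  rewrite lee_fin => rc /le_trans; apply.
  by rewrite -EFinD lee_fin; lra.
have lev q (e : R) : 0 <= e -> (w u q.1 <= (t + e)%:E)%E -> u q <= v q + e.
  move=> e0 /(clamp_le_max tt) ce; rewrite vE.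
  by have := ce _; rewrite lerDl => /(_ e0); rewrite -/(c q.1); lra.
have vu q : v q <= u q by rewrite vE; have := cP q.1; lra.
have vxy : v (x, y) = u (x, y).
  apply/eqP; rewrite eq_le vu /= -[leRHS]addr0; apply: lev => //=.
  by rewrite addr0 wx.
have wvx : w v x = t%:E.
  apply/eqP; rewrite eq_le wv /= -wx -[leRHS]adde0.
  apply: inf_perturbed_leD => y'; rewrite addr0 -[leRHS]addr0.
  by apply: lev => //=; rewrite addr0 wx.
have bv : opt v = t.
  apply/eqP; rewrite eq_le opt_le//= -lee_fin -wvx.
  exact: inf_perturbed_le.
exists v; split => //.
- apply: bcfun_dist_le => // q; rewrite vE.
  by have := cP q.1; rewrite ler_norml; lra.
- by apply/solution_mapP; rewrite bv /perturbed vxy.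
Qed.

Lemma perturbedD {u v q} {h : R} :
  v q = u q + h -> perturbed v q = (perturbed u q + h%:E)%E.
Proof. by rewrite /perturbed => ->; rewrite EFinD addeA. Qed.

(** * The four properties of the solution mapping *)

Lemma dense_solution_dom : dense (svdom (solution_map f K)).
Proof.
move=> O [u Ou] oO; have [e e0 eO] := open_bcfun_dist oO Ou.
have [|x ux] := @opt_gt u (opt u - e / 2); first lra.
have := inf_perturbed_le u x.
case wx : (w u x) ux => [t| |]//; rewrite lte_fin lee_fin => ut tu.
have [y Kxy yx] :=
  inf_value_attained K_nonempty K_compact (continuous_perturbed u) x.
rewrite wx in yx.
have [||v [uv Sv _ _ _]] := @cap_perturbation u x y t (e / 2) _ Kxy yx wx _;
  [lra..|].
by exists v; split; [apply: eO; lra | exists (x, y)].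
Qed.

Lemma closed_solution_graph : hausdorff_space Y ->
  closed (svgraph (solution_map f K)).
Proof.
move=> hY -[u q] uq; apply: solution_map_suff.
- suff /(closed_svgraph K_usc K_compact hY) : closure (svgraph K) q by [].
  move=> B qB.
  have [|[v p] [/solution_mapP[/= Kp _ _] [_ Bp]]] := uq (setT `*` B).
    by exists (setT, B) => //=; split => //; exact: filterT.
  by exists p.
- rewrite leNgt; apply/negP => /EFin_lt_gap[e e0].
  move=> /(near_gt_continuous (continuous_perturbed _)) uq'.
  have [|[v p] [/solution_mapP[/= _ vp _] [/= uv eup]]] :=
    uq ([set v | `|u - v| < e / 2] `*`
        [set p | (opt u + e)%:E < perturbed u p]%E).
    exists ([set v | `|u - v| < e / 2],
            [set p | (opt u + e)%:E < perturbed u p]%E) => //=.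
    by split => //; apply: nbhs_bcfun_dist; lra.
  have := lt_le_trans eup (perturbed_leD (bcfun_le_dist u v p)).
  by rewrite vp -EFinD lte_fin; have := opt_dist v u; rewrite (distrC v u); lra.
- rewrite leNgt; apply/negP => /lt_EFin_gap[e e0].
  move=> /(near_lt_continuous (continuous_inf_perturbed _)) uq'.
  have [|[v p] [/solution_mapP[/= _ _ vp] [/= uv eup]]] :=
    uq ([set v | `|u - v| < e / 2] `*`
        [set p : X * Y | w u p.1 < (opt u - e)%:E]%E).
    exists ([set v | `|u - v| < e / 2],
            [set p : X * Y | w u p.1 < (opt u - e)%:E]%E) => //=.
    split; first by apply: nbhs_bcfun_dist; lra.
    exact: (cvg_fst uq').
  have := inf_perturbed_dist v u p.1.
  rewrite vp -leeBlDr// -EFinB => /le_lt_trans/(_ eup).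
  by rewrite lte_fin; have := opt_dist u v; rewrite (distrC v u); lra.
Qed.

Lemma open_into_solution_map : open_into (solution_map f K) (svgraph K).
Proof.
move=> O oO.
exists (interior [set q | svgraph K q -> svimage (solution_map f K) O q]).
  exact: open_interior.
apply/seteqP; split; last by move=> q [Kq /interior_subset]; exact.
move=> q0 [u0 Ou0 /solution_mapP[Kq0 uq0 wq0]]; split => //.
have [e e0 eO] := open_bcfun_dist oO Ou0; pose d := e / 6.
(* Lifting costs 2 d and capping costs 3 d; the sum stays below e. *)
have d0 : 0 < d by rewrite /d; lra.
have near1 : \forall q \near q0, ((opt u0 - d)%:E < perturbed u0 q)%E.
  by apply: (near_gt_continuous (continuous_perturbed _)); rewrite uq0 lte_fin; lra.
have near2 : \forall q \near q0, (perturbed u0 q < (opt u0 + d)%:E)%E.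
  by apply: (near_lt_continuous (continuous_perturbed _)); rewrite uq0 lte_fin; lra.
have near3 : \forall q \near q0, ((opt u0 - d)%:E < w u0 q.1)%E.
  have n1 : \forall x \near q0.1, ((opt u0 - d)%:E < w u0 x)%E.
    apply: (near_gt_continuous (continuous_inf_perturbed _)).
    by rewrite wq0 lte_fin; lra.
  exact: (cvg_fst n1).
apply: filterS3 near1 near2 near3 => -[x y] /=.
case uxy : (perturbed u0 (x, y)) => [t| |]//; rewrite !lte_fin => ts st sx Kxy.
(* On K x the values of f + u0 exceed t - 2 d, so adding h raises each one to at
   least t, while the value t at (x, y) is unchanged. *)
pose h q := t - clamp (t - 2 * d) t (perturbed u0 q).
have dt : t - 2 * d <= t by lra.
have hP q : 0 <= h q <= 2 * d.
  have := clamp_ge (perturbed u0 q) dt.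
  by have := clamp_le (perturbed u0 q) dt; rewrite /h; lra.
have ch : continuous (fun q => u0 q + h q).
  move=> q; apply: cvgD; first exact: bcfun_continuous.
  apply: cvgB; first exact: cvg_cst.
  by apply: continuous_comp; [exact: continuous_perturbed|exact: continuous_clamp].
have [|u1 u1E] := @exists_bcfun _ _ _ (`|u0| + 2 * d) ch.
  move=> q; apply: le_trans (ler_normD _ _) _; apply: lerD.
    exact: (le_sup_norm u0).
  by have := hP q; rewrite ler_norml; lra.
have u1xy : perturbed u1 (x, y) = t%:E.
  rewrite (perturbedD (u1E (x, y))) uxy -EFinD /h uxy /=.
  by rewrite max_l// minxx subrr addr0.
have w1x : w u1 x = t%:E.
  apply/eqP; rewrite eq_le -{1}u1xy inf_value_le//=.
  apply: le_ereal_inf_tmp => _ [y' Kxy' <-].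
  have := lt_le_trans sx (inf_value_le Kxy').
  rewrite (perturbedD (u1E (x, y'))) /h; case: (perturbed u0 (x, y')) => [r| |]//=.
    rewrite -EFinD lte_fin lee_fin => sr.
    have : Num.min (Num.max r (t - 2 * d)) t <= r.
      by rewrite ge_min ge_max lexx /=; apply/orP; left; lra.
    lra.
  by rewrite leey.
have bu1 : opt u1 <= t + 3 * d.
  have : opt u1 <= opt u0 + 2 * d.
    by apply: opt_leD => q; rewrite u1E; have := hP q; lra.
  lra.
have [|v [uv Sv _ _ _]] := @cap_perturbation u1 x y t (3 * d) _ Kxy u1xy w1x bu1.
  lra.
exists v => //; apply: eO.
have u01 : `|u0 - u1| <= 2 * d.
  apply: bcfun_dist_le => [|q]; first lra.
  by rewrite u1E ler_norml; have := hP q; lra.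
by apply: le_lt_trans (ler_distD u1 _ _) _; rewrite /d in uv u01 *; lra.
Qed.

Lemma quasi_continuous_solution_map :
  completely_regular_space X -> completely_regular_space Y ->
  quasi_continuous (solution_map f K).
Proof.
move=> crX crY U V oU oV.
move=> [[x0 y0] [[u0 Uu0 /solution_mapP[/= Kxy0 uxy0 wx0]] Vxy0]].
set s := opt u0 in uxy0 wx0.
have [r r0 rU] := open_bcfun_dist oU Uu0; pose d := r / 40.
(* With g = u0 + 8 d b(y) - 24 d a(x) below, the bump b can raise the optimal value
   by up to 8 d; the coefficient of a is three times larger so that points with
   a(x) = 1 lose even after this gain.  Then |u0 - g| <= 24 d and capping costs
   8 d, so that a ball of radius d around the result fits in U. *)
have d0 : 0 < d by rewrite /d; lra.
have [[A B] /= [xA yB] AB] := open_nbhs_nbhs (conj oV Vxy0).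
have [b [cb b01 by0 bB]] := completely_regular_bump (R := R) crY yB.
have uM := le_sup_norm u0.
have cub : continuous (fun q => u0 q + 8 * d * b q.2).
  move=> q; apply: cvgD; first exact: bcfun_continuous.
  apply: cvgM; first exact: cvg_cst.
  by apply: continuous_comp; [exact: cvg_snd|exact: cb].
have [|ub ubE] := @exists_bcfun _ _ _ (sup_norm u0 + 8 * d) cub.
  by move=> q; have := b01 q.2; have := uM q; rewrite !ler_norml; nra.
have ub0 : ub (x0, y0) = u0 (x0, y0) by rewrite ubE by0 mulr0 addr0.
have ubx0 : perturbed ub (x0, y0) = s%:E by rewrite /perturbed ub0.
have wbx0 : w ub x0 = s%:E.
  apply/eqP; rewrite eq_le -{1}ubx0 inf_value_le//= -wx0 -[leRHS]adde0.
  apply: inf_perturbed_leD => y; rewrite ubE/= addr0.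
  by have := b01 y; nra.
(* On this neighbourhood of x0 the infimum is within d of s both before and after
   adding the bump in y, so that capping changes g by at most d there. *)
pose A' := [set x | [/\ A x, (s - d)%:E < w u0 x & w ub x < (s + d)%:E]%E].
have xA' : nbhs x0 A'.
  have n1 : \forall x \near x0, ((s - d)%:E < w u0 x)%E.
    apply: (near_gt_continuous (continuous_inf_perturbed _)).
    by rewrite wx0 lte_fin; lra.
  have n2 : \forall x \near x0, (w ub x < (s + d)%:E)%E.
    apply: (near_lt_continuous (continuous_inf_perturbed _)).
    by rewrite wbx0 lte_fin; lra.
  by apply: filterS3 xA n1 n2 => x.
have [a [ca a01 ax0 aA']] := completely_regular_bump (R := R) crX xA'.
have cg : continuous (fun q => ub q - 24 * d * a q.1).
  move=> q; apply: cvgB; first exact: bcfun_continuous.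
  apply: cvgM; first exact: cvg_cst.
  by apply: continuous_comp; [exact: cvg_fst|exact: ca].
have [|g gE] := @exists_bcfun _ _ _ (sup_norm u0 + 32 * d) cg.
  move=> q; rewrite ubE; have := b01 q.2; have := a01 q.1; have := uM q.
  by rewrite !ler_norml; nra.
have gxy0 : perturbed g (x0, y0) = s%:E.
  by rewrite /perturbed gE/= ax0 mulr0 subr0.
have wgx0 : w g x0 = s%:E.
  rewrite -wbx0; apply/eqP; rewrite eq_le; apply/andP; split.
    rewrite -[leRHS]adde0; apply: inf_perturbed_leD => y.
    by rewrite gE /= ax0; lra.
  rewrite -[leRHS]adde0; apply: inf_perturbed_leD => y.
  by rewrite gE /= ax0; lra.
have bg : opt g <= s + 8 * d.
  apply: opt_leD => q; rewrite gE ubE.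
  by have := b01 q.2; have := a01 q.1; nra.
have [|v [gv Sv bv vg lev]] :=
  @cap_perturbation g x0 y0 s (8 * d) _ Kxy0 gxy0 wgx0 bg.
  lra.
have u0g : `|u0 - g| <= 24 * d.
  apply: bcfun_dist_le => [|q]; first lra.
  rewrite gE ubE ler_norml.
  by have := b01 q.2; have := a01 q.1; nra.
exists [set u | `|v - u| < d]; split.
- by have := @ball_open _ _ v d; rewrite -ball_normE.
- by exists v => /=; rewrite subrr normr0.
- move=> u /= vu; apply: rU.
  apply: le_lt_trans (ler_distD g _ _) _.
  have : `|g - u| <= `|g - v| + `|v - u| by exact: ler_distD.
  by rewrite /d in vu gv u0g *; lra.
move=> [x y] [u /= vu /solution_mapP[/= Kxy uxy wx]].
have bu : `|opt u - s| <= d.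
  rewrite -bv ler_norml; have := opt_dist u v; have := opt_dist v u.
  by rewrite (distrC u v); lra.
(* From here on, (x, y) solves the problem for some u within d of v; near-optimality
   of w g x forces a x < 1, hence x in A', and then a x is so small that the low
   value of f + u at (x, y) forces b y < 1. *)
have wgx : ((s - 2 * d)%:E <= w g x)%E.
  have : (w u x <= w g x + d%:E)%E.
    apply: inf_perturbed_leD => y'.
    have := bcfun_le_dist u v (x, y'); have := vg (x, y').
    by rewrite (distrC u v); lra.
  rewrite wx -leeBlDr// -EFinB; apply: le_trans; rewrite lee_fin.
  by move: bu; rewrite ler_norml; lra.
have ax : a x < 1.
  have : (w g x <= w u0 x + (8 * d - 24 * d * a x)%:E)%E.
    apply: inf_perturbed_leD => y'; rewrite gE ubE /=.
    by have := b01 y'; nra.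
  move=> /(le_trans wgx)/le_trans/(_ (leeD2r _ (inf_perturbed_le u0 x))).
  by rewrite -EFinD lee_fin -/s; nra.
have [Ax sx xs] := aA' _ ax.
have wgb : (w g x <= w ub x + (- (24 * d * a x))%:E)%E.
  by apply: inf_perturbed_leD => y'; rewrite gE.
have ad : 24 * d * a x <= 3 * d.
  have := le_lt_trans (le_trans wgx wgb) (lte_leD _ xs (lexx _)).
  by rewrite -EFinD lte_fin => /(_ isT); lra.
have wgs : (w g x <= (s + d)%:E)%E.
  apply: le_trans (ltW xs); rewrite -[leRHS]adde0.
  apply: inf_perturbed_leD => y'; rewrite gE /=.
  by have := a01 x; nra.
apply: AB; split => //=; apply: bB.
have := lev (x, y) d (ltW d0) wgs.
rewrite gE ubE /= => vlow.
have := bcfun_le_dist v u (x, y).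
have := lt_le_trans sx (inf_value_le Kxy).
have : perturbed u0 (x, y) = (perturbed u (x, y) + (u0 (x, y) - u (x, y))%:E)%E.
  by apply: perturbedD; lra.
rewrite uxy => ->; rewrite -EFinD lte_fin.
by move: bu; rewrite ler_norml; nra.
Qed.

End Perturbation.

Theorem proposition2p4 (R : realType) (X Y : topologicalType)
    (f : X * Y -> \bar R) (K : X -> set Y)
    (crX : completely_regular_space X) (hX : hausdorff_space X)
    (crY : completely_regular_space Y) (hY : hausdorff_space Y)
    (K_nonempty : forall x, K x !=set0)
    (w_bounded_above : exists M : R, forall x, (inf_value K f x <= M%:E)%E)
    (w_proper : exists x, inf_value K f x \is a fin_num)
    (f_cont : continuous f)
    (K_lsc : lsc K) (K_usc : usc K) (K_compact : forall x, compact (K x)) :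
  [/\ dense (svdom (solution_map f K)),
      closed (svgraph (solution_map f K)),
      quasi_continuous (solution_map f K) &
      open_into (solution_map f K) (svgraph K)].
Proof.
split.
- exact: dense_solution_dom.
- exact: closed_solution_graph.
- exact: quasi_continuous_solution_map.
- exact: open_into_solution_map.
Qed.
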